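(* There is no strongly co-edge-regular graph with parameters $(n,k,2,\ell)$ and smallest eigenvalue $\theta_{\min}$ satisfying $\theta_{\min}\geqslant-3$, $k\geqslant 120$ and $\ell<\frac{3k}{4}$.
   Context: All graphs are finite, undirected and simple; eigenvalues are those of the adjacency matrix. A co-edge-regular graph with parameters $(n,k,c)$ is a $k$-regular graph on $n$ vertices, neither complete nor edgeless, in which any two distinct non-adjacent vertices have exactly $c$ common neighbours. For adjacent $x,y$, $a_{xy}$ is the number of common neighbours of $x,y$. A strongly co-edge-regular graph with parameters $(n,k,c,\ell)$ is a co-edge-regular graph with parameters $(n,k,c)$ such that for any two distinct non-adjacent vertices $x,z$, $\sum_{y\sim x,\,y\sim z}a_{xy}=\ell$. *)

(* Defs.v *)
From HB Require Import structures.
From mathcomp Require Import all_boot all_order all_algebra.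

Set Implicit Arguments.
Unset Strict Implicit.
Unset Printing Implicit Defensive.

Import Order.TTheory GRing.Theory Num.Theory.

Local Open Scope ring_scope.

Record sgraph := SGraph {
  vertex :> finType;
  adj : rel vertex;
  adj_sym : symmetric adj;
  adj_irr : irreflexive adj
}.

Definition nbhd (G : sgraph) (x : G) : {set G} := [set y | adj x y].

Definition common_nbrs (G : sgraph) (x y : G) : {set G} := nbhd x :&: nbhd y.

Definition complete (G : sgraph) : Prop :=
  forall x y : G, x != y -> adj x y.

Definition edgeless (G : sgraph) : Prop := forall x y : G, ~~ adj x y.

Definition regular (G : sgraph) (k : nat) : Prop :=
  forall x : G, #|nbhd x| = k.

Definition co_edge_regular (G : sgraph) (n k c : nat) : Prop :=
  [/\ #|G| = n, regular G k, ~ complete G, ~ edgeless G &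
      forall x y : G, x != y -> ~~ adj x y -> #|common_nbrs x y| = c].

Definition strongly_co_edge_regular (G : sgraph) (n k c l : nat) : Prop :=
  co_edge_regular G n k c /\
  forall x z : G, x != z -> ~~ adj x z ->
    (\sum_(y in common_nbrs x z) #|common_nbrs x y|)%N = l.

Definition adjmx (R : nzRingType) (G : sgraph) : 'M[R]_#|G| :=
  \matrix_(i, j) (adj (enum_val i) (enum_val j))%:R.

(* Over a real closed field the symmetric matrix [adjmx R G] has all of its
   eigenvalues in [R]. *)
Definition smallest_eigenvalue (R : rcfType) (G : sgraph) (theta : R) : Prop :=
  eigenvalue (adjmx R G) theta /\
  forall mu : R, eigenvalue (adjmx R G) mu -> theta <= mu.

(* Main.v *)
Require Import Defs.
From HB Require Import structures.
From mathcomp Require Import all_boot all_order all_algebra.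
From mathcomp Require Import sesquilinear spectral complex zify ring lra.

Set Implicit Arguments.
Unset Strict Implicit.
Unset Printing Implicit Defensive.

Import Order.TTheory GRing.Theory Num.Theory.

Local Open Scope ring_scope.

(**
  Write a(x, y) for the number of common neighbours of x and y. Positive
  semidefiniteness of A + 3I, tested on vectors constant on a clique D and on a
  set S joined to D, bounds the average degree inside S from below. With D = {x}
  this yields an edge at x with a(x, y) >= k/3 - 3 >= 37 and forbids ten
  independent neighbours of x; with D = {x, y} it puts every edge with
  a(x, y) >= 37 in a maximal clique with at least 19 vertices, since c = 2 makes
  the common neighbourhood of x and y a disjoint union of cliques.

  Let L be such a large clique. A vertex u outside L has at most two neighbours
  in L; if it has two, p and q, then the condition on l applied to u and the
  other vertices of L forces l = 2(|L| - 2), makes q the only vertex of L that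
  shares with p a neighbour outside L, and gives a(u, p) + a(u, q) = l.
    Averaging
  over the neighbourhood of p gives |L| >= 39, and an analysis of the common
  neighbours of p and q outside L leads to a contradiction. So the large cliques
  through x meet only in x and have no edges between them. As l < 3k/4, two
  cliques do not cover the neighbourhood of x, and it follows that a(x, y) = l/2
  for every edge. Hence every edge lies in exactly one large clique, all large
  cliques have t + 1 vertices with t = l/2 + 1, every vertex lies in exactly
  three of them, k = 3t and n = 3t^2 + 3t + 1. Then t + 1 divides
  3n = 9t(t + 1) + 3, which is impossible for t > 2.
*)

(** * The quadratic form of the adjacency matrix *)

Local Open Scope sesquilinear_scope.

(** Over the complex closure of [R] the symmetric matrix is Hermitian, hence unitarily
    diagonalisable. In the new coordinates both forms are sums of squared moduli, weighted by real
    eigenvalues on the right. *)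
Lemma rayleigh_ge (R : rcfType) (n : nat) (A : 'M[R]_n) (theta : R)
    (v : 'rV[R]_n) :
  A^T = A -> (forall mu, eigenvalue A mu -> theta <= mu) ->
  theta * (v *m v^T) 0 0 <= (v *m A *m v^T) 0 0.
Proof.
move=> symA minA.
pose f := real_complex R; pose AC := map_mx f A; pose vC := map_mx f v.
have fJ a : (f a)^* = f a by apply/CrealP; apply/complex_realP; exists a.
have hermA : AC \is hermsymmx.
  apply: realsym_hermsym.
    by apply/is_hermitianmxP; rewrite expr0 scale1r map_mx_id // map_trmx symA.
  by apply/mxOverP=> i j; rewrite mxE; apply/complex_realP; exists (A i j).
have := hermitian_spectral_diag_real hermA.
have /hermitian_normalmx/orthomx_spectralP := hermA.
have := spectral_unit AC; have := spectral_unitarymx AC.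
set P := spectralmx AC; set d := spectral_diag AC => unitaryP unitP defA realD.
(* Row [i] of [P] is an eigenvector for the diagonal entry [d 0 i]; as this entry is real, it comes
   from an eigenvalue of [A] over [R]. *)
have d_ge i : f theta <= d 0 i.
  have /mxOverP/(_ 0 i)/complex_realP[mu def_d] := realD.
  rewrite def_d lecR minA // -(eigenvalue_map f) -/AC.
  apply/eigenvalueP; exists (row i P).
    rewrite -row_mul defA -mulmxA mulKVmx // row_mul row_diag_mx -scalemxAl.
    by rewrite -rowE def_d.
  rewrite rowE; apply/eqP=> /(congr1 (mulmx^~ (invmx P))).
  rewrite mulmxK // mul0mx => /matrixP/(_ 0 i).
  by rewrite !mxE !eqxx => /eqP; rewrite oner_eq0.
pose w := vC *m P ^t*.
have vvT : (vC *m vC^T) = w *m w ^t*.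
  rewrite /w trmx_mul map_mxM trmxCK mulmxA mulmxKtV //.
  by congr (_ *m _); apply/matrixP=> i j; rewrite !mxE; exact: esym (fJ _).
have vAvT : (vC *m AC *m vC^T) = w *m diag_mx d *m w ^t*.
  rewrite defA invmx_unitary // /w trmx_mul map_mxM trmxCK !mulmxA.
  by congr (_ *m _ *m _); apply/matrixP=> i j; rewrite !mxE; exact: esym (fJ _).
have toC (M : 'M[R]_1) : f (M 0 0) = (map_mx f M) 0 0 by rewrite mxE.
have fM a b : f (a * b) = f a * f b := rmorphM f a b.
have vvE : f ((v *m v^T) 0 0) = (vC *m vC^T) 0 0.
  by rewrite toC map_mxM -map_trmx.
have vAvE : f ((v *m A *m v^T) 0 0) = (vC *m AC *m vC^T) 0 0.
  by rewrite toC !map_mxM -map_trmx.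
rewrite -lecR -/f fM vvE vAvE vvT vAvT !mxE mulr_sumr ler_sum // => i _.
rewrite mul_mx_diag !mxE mulrAC mulrC ler_wpM2l ?d_ge //.
exact: mul_conjC_ge0.
Qed.

Local Close Scope sesquilinear_scope.

Lemma adjmx_form_ge (R : rcfType) (G : sgraph) (theta : R) (g : G -> R) :
    smallest_eigenvalue G theta ->
  theta * (\sum_x g x ^+ 2) <= \sum_x \sum_(y | adj x y) g x * g y.
Proof.
move=> [_ minG].
have symA : (adjmx R G)^T = adjmx R G.
  by apply/matrixP=> i j; rewrite !mxE adj_sym.
have := rayleigh_ge (\row_i g (enum_val i)) symA minG.
rewrite !mxE; congr (_ * _ <= _).
  rewrite (reindex _ (onW_bij _ (@enum_val_bij G))) /=.
  by apply: eq_bigr => i _; rewrite !mxE.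
rewrite [RHS](reindex _ (onW_bij _ (@enum_val_bij G))) /=.
apply: eq_bigr => i _; rewrite !mxE mulr_suml.
rewrite [RHS](reindex _ (onW_bij _ (@enum_val_bij G))) /= [RHS]big_mkcond.
apply: eq_bigr => j _; rewrite !mxE.
by rewrite adj_sym mulrAC [g _ * g _]mulrC; case: adj; rewrite ?mulr1 ?mulr0.
Qed.

(** Ordered pairs are counted, so [edges_between S S] is the degree sum inside [S], twice its number
    of edges. *)
Definition edges_between (G : sgraph) (S T : {set G}) : nat :=
  \sum_(x in S) #|nbhd x :&: T|.

Lemma sum_adj_indicator (R : nzRingType) (G : sgraph) (S T : {set G}) :
  \sum_x \sum_(y | adj x y) (x \in S)%:R * (y \in T)%:R
    = (edges_between S T)%:R :> R.
Proof.
rewrite /edges_between natr_sum [RHS]big_mkcond; apply: eq_bigr => x _.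
case: (x \in S); last by rewrite big1 // => y _; rewrite mul0r.
rewrite -sum1_card natr_sum big_mkcond [RHS]big_mkcond; apply: eq_bigr => y _.
by rewrite !inE mul1r; case: adj; case: (y \in T).
Qed.

(* Evaluate the form of A + 3I on (|D| + 2) 1_S - |S| 1_D. *)
Lemma clique_join_bound (R : rcfType) (G : sgraph) (theta : R) (D S : {set G}) :
    smallest_eigenvalue G theta -> -3 <= theta -> (0 < #|D|)%N ->
    {in D &, forall x y, x != y -> adj x y} ->
    {in D & S, forall x y, adj x y} ->
  (#|D| * #|S| ^ 2 <= (#|D| + 2) * (3 * #|S| + edges_between S S))%N.
Proof.
move=> minG theta_ge D_gt0 cliqueD joinDS.
set m := #|D|; set s := #|S|; set e := edges_between S S.
have disj x : (x \in S) && (x \in D) = false.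
  by apply/negP=> /andP[xS xD]; have := joinDS x x xD xS; rewrite adj_irr.
have eDD : edges_between D D = (m * m.-1)%N.
  rewrite /edges_between (eq_bigr (fun=> m.-1)) ?sum_nat_const // => x xD.
  suff -> : nbhd x :&: D = D :\ x by rewrite /m (cardsD1 x D) xD.
  apply/setP=> y; rewrite !inE andbC [RHS]andbC;
    case: (boolP (y \in D)) => //= yD.
  have [->|neq] := eqVneq y x; first by rewrite adj_irr.
  by rewrite cliqueD // eq_sym.
have eDS : edges_between D S = (m * s)%N.
  rewrite /edges_between (eq_bigr (fun=> s)) ?sum_nat_const // => x xD.
  suff -> : nbhd x :&: S = S by [].
  by apply/setIidPr/subsetP=> y yS; rewrite inE joinDS.
have eSD : edges_between S D = (m * s)%N.
  rewrite /edges_between (eq_bigr (fun=> m)) ?sum_nat_const 1?mulnC // => x xS.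
  suff -> : nbhd x :&: D = D by [].
  by apply/setIidPr/subsetP=> y yD; rewrite inE adj_sym joinDS.
pose a : R := (m + 2)%:R; pose b : R := - s%:R.
pose g x : R := a * (x \in S)%:R + b * (x \in D)%:R.
have sq : \sum_x g x ^+ 2 = a ^+ 2 * s%:R + b ^+ 2 * m%:R.
  rewrite /s /m -!sum1_card !natr_sum !mulr_sumr [X in X + _]big_mkcond.
  rewrite [X in _ + X]big_mkcond -big_split; apply: eq_bigr => x _ /=.
  by rewrite /g; case: (x \in S) (x \in D) (disj x) => [] [] //= _; ring.
have form : \sum_x \sum_(y | adj x y) g x * g y =
    a ^+ 2 * e%:R + a * b * (m * s)%:R *+ 2 + b ^+ 2 * (m * m.-1)%:R.
  rewrite -eDD mulr2n -[in X in _ + (X + _)]eSD -eDS.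
  rewrite -!sum_adj_indicator !mulr_sumr -!big_split; apply: eq_bigr => x _ /=.
  rewrite !mulr_sumr -!big_split; apply: eq_bigr => y _ /=.
  by rewrite /g; ring.
have := adjmx_form_ge g minG; rewrite sq form => main.
have sq_ge0 : 0 <= a ^+ 2 * s%:R + b ^+ 2 * m%:R.
  by rewrite -sq sumr_ge0 // => x _; rewrite sqr_ge0.
have := ler_wpM2r sq_ge0 theta_ge => le3.
have {}main := le_trans le3 main.
have Dm : m%:R = m.-1%:R + 1 :> R by rewrite natr1 prednK.
(* Moving the [-3] terms over gives [0 <= a^2 (3s + e) - 2 a m s^2 + s^2 m (m + 2)]; since
   [m + 2 = a], a factor [a] comes out. *)
have : a * (m * s ^ 2)%:R <= a * ((m + 2) * (3 * s + e))%:R.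
  move: main; rewrite /a /b; rewrite !natrM ?natrX !natrD ?natrM Dm.
  by move=> main; lra.
by rewrite ler_pM2l ?ler_nat // ltr0n addn2.
Qed.

(** * Large cliques *)

Lemma in_nbhd (G : sgraph) (x y : G) : (y \in nbhd x) = adj x y.
Proof. by rewrite inE. Qed.

Lemma in_common (G : sgraph) (x y z : G) :
  (z \in common_nbrs x y) = adj x z && adj y z.
Proof. by rewrite !inE. Qed.

Lemma common_nbrsC (G : sgraph) (x y : G) : common_nbrs x y = common_nbrs y x.
Proof. exact: setIC. Qed.

Lemma adj_neq (G : sgraph) (x y : G) : adj x y -> x != y.
Proof. by apply: contraTneq => ->; rewrite adj_irr. Qed.

(* The bound 19 is what [exists_large_clique] obtains from [37 <= a x y]. *)
Definition large_clique (G : sgraph) (L : {set G}) : bool :=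
  [&& [forall x in L, forall y in L, (x != y) ==> adj x y],
      [forall v, (v \notin L) ==> [exists w in L, ~~ adj v w]] & (19 <=
        #|L|)%N].

(** The configuration that [no_exit] finally excludes, so that large cliques become the lines of a
    partial linear space. *)
Definition exit_triple (G : sgraph) (L : {set G}) (p q u : G) : bool :=
  [&& (p \in L) && (q \in L), p != q, u \notin L, adj u p & adj u q].

Section StronglyCoEdgeRegular.

Local Open Scope nat_scope.

Variables (G : sgraph) (k l : nat).

Hypothesis regG : regular G k.
Hypothesis not_completeG : ~ complete G.
Hypothesis common2 :
  forall x y : G, x != y -> ~~ adj x y -> #|common_nbrs x y| = 2.
Hypothesis sum_common : forall x z : G, x != z -> ~~ adj x z ->
  \sum_(y in common_nbrs x z) #|common_nbrs x y| = l.
Hypothesis k_ge120 : 120 <= k.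
Hypothesis l_lt : 4 * l < 3 * k.
Hypothesis clique_join : forall D S : {set G}, 0 < #|D| ->
  {in D &, forall x y, x != y -> adj x y} -> {in D & S, forall x y, adj x y} ->
  #|D| * #|S| ^ 2 <= (#|D| + 2) * (3 * #|S| + edges_between S S).

Implicit Types (x y z u v w p q : G) (L S T D : {set G}).

Local Notation a x y := #|common_nbrs x y|.

Lemma adj_of_three_common x y p q r : x != y -> uniq [:: p; q; r] ->
  {subset [:: p; q; r] <= common_nbrs x y} -> adj x y.
Proof.
move=> neq_xy uniq3 sub3; apply/negPn/negP=> /(common2 neq_xy) card2.
suff : 3 <= #|common_nbrs x y| by rewrite card2.
rewrite -[3]/(size [:: p; q; r]) -(card_uniqP uniq3).
by apply/subset_leq_card/subsetP.
Qed.

Lemma common_pair x y p q : x != y -> ~~ adj x y -> p != q ->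
  p \in common_nbrs x y -> q \in common_nbrs x y ->
  common_nbrs x y = [set p; q].
Proof.
move=> neq_xy nadj_xy neq_pq pC qC; apply/esym/eqP.
rewrite eqEcard common2 // cards2 neq_pq andbT.
by apply/subsetP=> r; rewrite !inE -in_common => /orP[]/eqP->.
Qed.

Lemma degree_sum x z p q : x != z -> ~~ adj x z -> p != q ->
  p \in common_nbrs x z -> q \in common_nbrs x z -> a x p + a x q = l.
Proof.
move=> neq nadj neq_pq pC qC; rewrite -(sum_common neq nadj).
by rewrite (common_pair neq nadj neq_pq pC qC) big_setU1 ?inE // big_set1.
Qed.

Lemma other_common x y p : x != y -> ~~ adj x y -> p \in common_nbrs x y ->
  exists2 q, q != p & q \in common_nbrs x y.
Proof.
move=> neq nadj pC.
have : 0 < #|common_nbrs x y :\ p|.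
  by move: (cardsD1 p (common_nbrs x y)); rewrite pC common2 //; lia.
by case/card_gt0P=> q; rewrite in_setD1 => /andP[]; exists q.
Qed.

(** An average of [clique_join] over [S]: if every vertex of [S] fell short, the sum over [S] would
    violate it. *)
Lemma exists_inner_degree D S : 0 < #|D| -> 0 < #|S| ->
  {in D &, forall x y, x != y -> adj x y} -> {in D & S, forall x y, adj x y} ->
  exists2 y, y \in S & #|D| * #|S| <= (#|D| + 2) * (3 + #|nbhd y :&: S|).
Proof.
move=> D_gt0 S_gt0 cliqueD joinDS; apply/exists_inP; apply: contraT.
rewrite negb_exists_in => /forall_inP small.
have := clique_join D_gt0 cliqueD joinDS; rewrite leqNgt => /negP[].
have -> : (#|D| + 2) * (3 * #|S| + edges_between S S) =
    \sum_(y in S) (#|D| + 2) * (3 + #|nbhd y :&: S|).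
  by rewrite -big_distrr big_split sum_nat_const /= [#|S| * 3]mulnC.
have -> : #|D| * #|S| ^ 2 = \sum_(y in S) (#|D| * #|S|).
  by rewrite sum_nat_const mulnCA mulnn.
have [y0 y0S] : exists y, y \in S by apply/card_gt0P.
rewrite (bigD1 y0) //= [X in _ < X](bigD1 y0) //= -addSn.
apply: leq_add; first by rewrite ltnNge small.
by apply: leq_sum => y /andP[/small]; rewrite -ltnNge => /ltnW.
Qed.

(** With [D = {x}] and inner degree 0 the bound reads [#|S| <= 3 * 3]. *)
Lemma independent_le9 x S : S \subset nbhd x ->
  {in S &, forall y z, ~~ adj y z} -> #|S| <= 9.
Proof.
move=> /subsetP subS indep.
case: (posnP #|S|) => [-> //|S_gt0].
have [|//|||y yS] := @exists_inner_degree [set x] S.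
- by rewrite cards1.
- by move=> u v; rewrite !inE => /eqP-> /eqP->; rewrite eqxx.
- by move=> u v; rewrite inE => /eqP-> /subS; rewrite inE.
have -> : nbhd y :&: S = set0.
  by apply/setP=> z; rewrite !inE; apply/negP=> /andP[yz /(indep y z yS)/negP].
rewrite cards1 cards0; lia.
Qed.

(** Here [D = {x}] and [S = nbhd x] give [k <= 3 * (3 + a x y)], and [120 <= k]. *)
Lemma exists_degree_ge37 x : exists2 y, adj x y & 37 <= a x y.
Proof.
have [||||y] := @exists_inner_degree [set x] (nbhd x).
- by rewrite cards1.
- by rewrite regG; lia.
- by move=> u v; rewrite !inE => /eqP-> /eqP->; rewrite eqxx.
- by move=> u v; rewrite !inE => /eqP->.
by rewrite inE cards1 regG setIC => xy bound; exists y => //; move: bound;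
  rewrite /common_nbrs; lia.
Qed.

(** Otherwise [x], [y], [q] would be three common neighbours of [p] and [p']. Hence the common
    neighbourhood of an edge is a disjoint union of cliques. *)
Lemma diamond_free x y q p p' : adj x y -> adj q p -> adj q p' ->
  q \in common_nbrs x y -> p \in common_nbrs x y -> p' \in common_nbrs x y ->
  p != p' -> adj p p'.
Proof.
rewrite !in_common => xy qp qp' /andP[xq yq] /andP[xp yp] /andP[xp' yp'] neq.
apply: (adj_of_three_common neq (p:=x) (q:=y) (r:=q)).
  by rewrite /= !inE negb_or !adj_neq.
by move=> r; rewrite !inE => /or3P[]/eqP->;
  rewrite ![adj p _]adj_sym ![adj p' _]adj_sym ?xp ?xp' ?yp ?yp' ?qp ?qp'.
Qed.

Lemma clique_adj L p q :
  large_clique L -> p \in L -> q \in L -> p != q -> adj p q.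
Proof. by case/and3P=> /forall_inP cL _ _ /cL/forall_inP cp /cp/implyP. Qed.

Lemma clique_max L v :
  large_clique L -> v \notin L -> exists2 w, w \in L & ~~ adj v w.
Proof. by case/and3P=> _ /forallP/(_ v)/implyP mL _ /mL/exists_inP. Qed.

Lemma clique_size L : large_clique L -> 19 <= #|L|.
Proof. by case/and3P. Qed.

Lemma exists_large_clique x y : adj x y -> 37 <= a x y ->
  exists L, [/\ large_clique L, x \in L & y \in L].
Proof.
move=> xy a_ge; have neq_xy := adj_neq xy.
have [||||q qT bound] := @exists_inner_degree [set x; y] (common_nbrs x y).
- by rewrite cards2; case: (_ != _).
- by lia.
- by move=> u v; rewrite !inE => /orP[]/eqP-> /orP[]/eqP->;
  rewrite ?eqxx // adj_sym.
- by move=> u v; rewrite in_common !inE => /orP[]/eqP-> /andP[].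
have [xq yq] : adj x q /\ adj y q by apply/andP; rewrite -in_common.
set K := nbhd q :&: common_nbrs x y in bound.
(* [K] with [q] is a component of the common neighbourhood, thus a clique; a vertex adjacent to [x],
   [y] and [q] already lies in [K], which yields maximality. *)
pose L := [set x; y; q] :|: K.
have Ladj u v : u \in K -> v \in L -> u != v -> adj u v.
  rewrite !inE => /and3P[qu xu yu] vL neq.
  case/orP: vL => [|/and3P[qv xv yv]].
    by case/orP=> [/orP[]|] /eqP->; rewrite adj_sym.
  by apply: (@diamond_free x y q) => //; rewrite in_common; apply/andP.
exists L; split; last 2 first; rewrite ?inE ?eqxx ?orbT //.
apply/and3P; split.
- apply/forall_inP=> u uL; apply/forall_inP=> v vL; apply/implyP=> neq.
  have [uK|uK] := boolP (u \in K); first exact: Ladj.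
  have [vK|vK] := boolP (v \in K); first by rewrite adj_sym Ladj // eq_sym.
  move: uL vL neq; rewrite ![_ \in L]in_setU (negPf uK) (negPf vK) !orbF !inE.
  by case/orP=> [/orP[]|] /eqP-> /orP[/orP[]|] /eqP->; rewrite ?eqxx // adj_sym.
- apply/forallP=> v; apply/implyP; apply: contraR.
  rewrite negb_exists_in => /forall_inP vL.
  have vadj w : w \in L -> adj w v by move=> /vL; rewrite negbK adj_sym.
  by rewrite !inE !vadj ?inE ?eqxx ?orbT.
have disj : [disjoint [set x; y; q] & K].
  rewrite disjoint_subset; apply/subsetP=> v; rewrite !inE.
  by case/orP=> [/orP[]|] /eqP->; rewrite adj_irr ?andbF.
rewrite /L cardsU disjoint_setI0 // cards0 subn0.
have -> : #|[set x; y; q]| = 3.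
  rewrite setUC cardsU1 cards2 !inE neq_xy.
  by rewrite negb_or ![q == _]eq_sym !adj_neq.
(* From [2 * 37 <= 4 * (3 + #|K|)] follows [16 <= #|K|], and [x], [y], [q] bring the size to 19. *)
by move: bound; rewrite cards2 neq_xy; lia.
Qed.

(** * Vertices outside a large clique with two neighbours in it *)

Section LargeClique.

Variable L : {set G}.
Hypothesis largeL : large_clique L.

Lemma exit_tripleI p q u : p \in L -> q \in L -> p != q -> u \notin L ->
  adj u p -> adj u q -> exit_triple L p q u.
Proof. by move=> pL qL *; apply/and5P; split=> //; apply/andP. Qed.

Lemma exit_tripleC p q u : exit_triple L p q u -> exit_triple L q p u.
Proof. by case/and5P=> /andP[? ?] ? ? ? ?; apply: exit_tripleI;
  rewrite // eq_sym. Qed.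

(** With a third neighbour [w] in [L], the vertex [u] would share [p], [q], [w] with every other
    vertex of [L] and be adjacent to it, against maximality. *)
Lemma exit_nonadj p q u w : exit_triple L p q u -> w \in L -> w != p ->
  w != q -> ~~ adj u w.
Proof.
case/and5P => /andP[pL qL] neq_pq uL up uq wL neq_wp neq_wq.
have [w0 w0L nadj] := clique_max largeL uL.
apply: contra nadj => uw.
have [-> //|neq_w] := eqVneq w0 w.
have [-> //|neq_p] := eqVneq w0 p.
have [-> //|neq_q] := eqVneq w0 q.
apply: (adj_of_three_common (p:=p) (q:=q) (r:=w)).
- by apply: contraNneq uL => ->.
- by rewrite /= !inE negb_or neq_pq ![_ == w]eq_sym neq_wp neq_wq.
by move=> r; rewrite !inE => /or3P[]/eqP->;
  rewrite ?up ?uq ?uw (clique_adj largeL).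
Qed.

Lemma exit_common p q u w : exit_triple L p q u -> w \in L -> w != p ->
  w != q -> [/\ u != w, ~~ adj u w, p \in common_nbrs u w &
                q \in common_nbrs u w].
Proof.
move=> ex wL wp wq; have nadj := exit_nonadj ex wL wp wq.
case/and5P: ex => /andP[pL qL] neq_pq uL up uq.
split=> //; first by apply: contraNneq uL => ->.
  by rewrite in_common up (clique_adj largeL).
by rewrite in_common uq (clique_adj largeL).
Qed.

Lemma card_common_clique p w : p \in L -> w \in L -> p != w ->
  a p w + 2 = #|L| + #|common_nbrs p w :\: L|.
Proof.
move=> pL wL neq.
rewrite -(cardsID L (common_nbrs p w)).
have -> : common_nbrs p w :&: L = L :\ p :\ w.
  apply/setP=> v; rewrite !inE -in_common.
  case: (boolP (v \in L)) => vL; rewrite ?andbF ?andbT //.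
  have [->|vp] := eqVneq v p; first by rewrite in_common adj_irr andbF.
  have [->|vw] := eqVneq v w; first by rewrite in_common adj_irr andbF.
  by rewrite in_common !(clique_adj largeL) // eq_sym.
rewrite (cardsD1 p L) pL (cardsD1 w (L :\ p)) !inE wL eq_sym neq; clear; lia.
Qed.

Lemma exit_tripleP p q : p \in L -> q \in L -> p != q ->
  reflect (exists u, exit_triple L p q u) (common_nbrs p q :\: L != set0).
Proof.
move=> pL qL neq; apply: (iffP (set0Pn _)) => -[u].
  rewrite in_setD in_common => /and3P[uL pu qu]; exists u.
  by apply: exit_tripleI; rewrite // adj_sym.
case/and5P => /andP[_ _] _ uL up uq; exists u.
by rewrite in_setD in_common uL ![adj _ u]adj_sym up uq.
Qed.

(** If [u] and [u'] were adjacent, [u] and [q'] would have the common neighbours [p], [q], [u'],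
    making [q'] a third neighbour of [u] in [L]. *)
Lemma exit_independent p q q' u u' : exit_triple L p q u ->
  exit_triple L p q' u' -> q != q' -> (u != u') && ~~ adj u u'.
Proof.
move=> ex ex' neq.
case/and5P: (ex) => /andP[pL qL] neq_pq uL up uq.
case/and5P: (ex') => /andP[_ q'L] neq_pq' u'L u'p u'q'.
have nadj : ~~ adj u q'.
  by apply: (exit_nonadj ex); rewrite // eq_sym.
have nadj' : ~~ adj u' q by apply: (exit_nonadj ex'); rewrite // eq_sym.
have neq_u : u != u' by apply: contraNneq nadj => ->.
rewrite neq_u; apply/negP=> uu'.
have neq_uq' : u != q' by apply: contraNneq uL => ->.
case/negP: nadj; apply: (adj_of_three_common neq_uq' (p:=p) (q:=q) (r:=u')).
  rewrite /= !inE negb_or neq_pq !andbT.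
  by apply/andP; split; apply: contraNneq u'L => <-.
move=> r; rewrite !inE => /or3P[]/eqP->; rewrite ?up ?uq ?uu' //=.
- by rewrite (clique_adj largeL) // eq_sym.
- by rewrite (clique_adj largeL) // eq_sym.
by rewrite adj_sym.
Qed.

Definition exit_points p := [set w in L :\ p | common_nbrs p w :\: L != set0].

(** One outside neighbour chosen for each exit point gives, injectively, an independent set in
    [nbhd p]. *)
Lemma card_exit_points p : p \in L -> #|exit_points p| <= 9.
Proof.
move=> pL.
(* The default [w] is never taken on [exit_points p]. *)
pose f w := odflt w [pick u in common_nbrs p w :\: L].
have fP w : w \in exit_points p -> exit_triple L p w (f w).
  rewrite !inE /f => /andP[/andP[wp wL] /set0Pn[u0 u0P]].
  case: pickP => [u|/(_ u0)]; last by rewrite u0P.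
  rewrite in_setD in_common => /and3P[uL pu wu].
  by apply: exit_tripleI; rewrite // 1?eq_sym // adj_sym.
rewrite -(card_in_imset (f := f)); last first.
  move=> w w' /fP ex /fP ex' eq_f; apply/eqP/negPn/negP=> neq.
  by have := exit_independent ex ex' neq; rewrite eq_f eqxx.
apply: (@independent_le9 p).
  by apply/subsetP=> u /imsetP[w /fP/and5P[_ _ _ up _] ->]; rewrite inE adj_sym.
move=> u u' /imsetP[w /fP ex ->] /imsetP[w' /fP ex' ->].
have [->|neq] := eqVneq w w'; first by rewrite adj_irr.
by case/andP: (exit_independent ex ex' neq).
Qed.

(** [p] and [q] are the two common neighbours of the non-adjacent pair [w], [u]. *)
Lemma exit_degree p q u w : exit_triple L p q u -> w \in L -> w != p ->
  w != q -> a w p + a w q = l.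
Proof.
move=> ex wL wp wq; have [uw nadj pC qC] := exit_common ex wL wp wq.
rewrite common_nbrsC in pC; rewrite common_nbrsC in qC.
have neq_pq : p != q by case/and5P: ex.
by apply: (degree_sum (z := u)); rewrite // 1?eq_sym 1?adj_sym.
Qed.

(** At most 9 + 9 vertices are exit points of [p] or [q], with [p] and [q] among them. As [#|L|] is
    at least 19, some [w] is neither, and then [a w p] and [a w q] both equal [#|L| - 2]. *)
Lemma exit_size p q u : exit_triple L p q u -> l + 4 = 2 * #|L|.
Proof.
move=> ex; case/and5P: (ex) => /andP[pL qL] neq_pq uL up uq.
suff /exists_inP[w wL /and3P[/andP[wp wq] /eqP tp /eqP tq]] :
    [exists w in L, [&& (w != p) && (w != q), common_nbrs w p :\: L == set0
                      & common_nbrs w q :\: L == set0]].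
  have := exit_degree ex wL wp wq.
  have := card_common_clique wL pL wp; have := card_common_clique wL qL wq.
  by rewrite tp tq cards0; clear; lia.
apply: contraT; rewrite negb_exists_in => /forall_inP noW.
suff sub : L \subset exit_points p :|: exit_points q.
  have := subset_leq_card sub; have := clique_size largeL.
  have := card_exit_points pL; have := card_exit_points qL.
  have := (leq_card_setU (exit_points p) (exit_points q)).1; clear; lia.
apply/subsetP=> w wL; rewrite !inE wL !andbT.
have [->|wp] := eqVneq w p.
  rewrite neq_pq /=; apply/(exit_tripleP qL pL); first by rewrite eq_sym.
  by exists u; apply: exit_tripleC.
have [->|wq] := eqVneq w q.
  by rewrite orbF /=; apply/(exit_tripleP pL qL neq_pq); exists u.
by have := noW w wL; rewrite wp wq /= negb_and ![common_nbrs w _]common_nbrsC.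
Qed.

(** The degrees [a p w] and [a q w] are each at least [#|L| - 2], while their sum is
    [l = 2 * (#|L| - 2)]. *)
Lemma exit_nonexit_degree p q u w : exit_triple L p q u -> w \in L ->
  w != p -> w != q -> a p w + 2 = #|L|.
Proof.
move=> ex wL wp wq; case/and5P: (ex) => /andP[pL qL] neq_pq uL up uq.
have := exit_degree ex wL wp wq; have := exit_size ex.
have := card_common_clique wL pL wp; have := card_common_clique wL qL wq.
rewrite [common_nbrs p w]common_nbrsC; clear; lia.
Qed.

(** For [w] other than [q], the outside neighbour [u'] would push [a p w] above [#|L| - 2]. *)
Lemma exit_unique p q u w u' :
  exit_triple L p q u -> exit_triple L p w u' -> w = q.
Proof.
move=> ex ex'; apply/eqP/negPn/negP=> wq.
case/and5P: (ex') => /andP[pL wL] neq_pw uL up uw.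
have wp : w != p by rewrite eq_sym.
have := exit_nonexit_degree ex wL wp wq.
have := card_common_clique pL wL neq_pw.
have : 0 < #|common_nbrs p w :\: L|.
  by rewrite card_gt0; apply/(exit_tripleP pL wL neq_pw); exists u'.
clear; lia.
Qed.

Lemma exit_outer_degree p q u : exit_triple L p q u -> a u p + a u q = l.
Proof.
move=> ex; case/and5P: (ex) => /andP[pL qL] neq_pq uL up uq.
have : 0 < #|L :\ p :\ q|.
  have := clique_size largeL.
  by rewrite (cardsD1 p) (cardsD1 q (L :\ p)) pL !inE qL andbT; clear; lia.
case/card_gt0P=> w; rewrite !inE => /and3P[wq wp wL].
have [uw nadj pC qC] := exit_common ex wL wp wq.
exact: (degree_sum (z := w)).
Qed.

End LargeClique.

(** * Adjacent twins and the bound of edge degrees by [l] *)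

Lemma exists_far x y : adj x y -> a x y + 1 < k ->
  exists z, [/\ adj y z, x != z & ~~ adj x z].
Proof.
move=> xy lt_ak; have : 0 < #|(nbhd y :\ x) :\: nbhd x|.
  have := cardsID (nbhd x) (nbhd y :\ x).
  have -> : (nbhd y :\ x) :&: nbhd x = common_nbrs x y.
    apply/setP=> z; rewrite !inE andbC; have [->|] := eqVneq z x => //=.
    by rewrite adj_irr.
  have := cardsD1 x (nbhd y); rewrite regG in_nbhd adj_sym xy.
  by move: lt_ak; clear; lia.
case/card_gt0P=> z; rewrite !inE => /and3P[nxz zx yz].
by exists z; rewrite eq_sym.
Qed.

(** The hypothesis [k <= a x y + 1] says that [x] and [y] have the same closed neighbourhood, as the
    common neighbours exhaust [nbhd x] without [y]. *)
Lemma twin_adj x y q : adj x y -> k <= a x y + 1 -> adj x q -> q != y ->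
  adj y q.
Proof.
move=> xy le_ka xq qy.
have /eqP/setP/(_ q) : common_nbrs x y == nbhd x :\ y.
  rewrite eqEcard; apply/andP; split; last first.
    have := cardsD1 y (nbhd x); rewrite regG in_nbhd xy.
    by move: le_ka; clear; lia.
  apply/subsetP=> z; rewrite !inE => /andP[-> yz]; rewrite andbT eq_sym.
  exact: adj_neq.
by rewrite in_common in_setD1 in_nbhd xq qy.
Qed.

(** Any two neighbours of [x] share [x], [y], [p] (or are among them), so [nbhd x] is a clique; it
    then follows that [x] is adjacent to everything and [G] is complete. *)
Lemma no_three_twins x y p : adj x y -> adj x p -> y != p ->
  k <= a x y + 1 -> k <= a x p + 1 -> False.
Proof.
move=> xy xp neq_yp twin_y twin_p.
have yP := twin_adj xy twin_y; have pP := twin_adj xp twin_p.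
have clq u v : adj x u -> adj x v -> u != v -> adj u v.
  move=> xu xv neq.
  have [eq_uy|uy] := eqVneq u y; first by rewrite eq_uy yP // -eq_uy eq_sym.
  have [eq_up|up] := eqVneq u p; first by rewrite eq_up pP // -eq_up eq_sym.
  have [->|vy] := eqVneq v y; first by rewrite adj_sym yP.
  have [->|vp] := eqVneq v p; first by rewrite adj_sym pP.
  apply: (adj_of_three_common neq (p:=x) (q:=y) (r:=p)).
    by rewrite /= !inE negb_or neq_yp !adj_neq.
  move=> r; rewrite !inE ![adj _ r]adj_sym.
  by case/or3P=> /eqP->;
    rewrite ?xu ?xv ?(yP _ xu uy) ?(yP _ xv vy) ?(pP _ xu up) ?(pP _ xv vp).
have univ z : z != x -> adj x z.
  rewrite eq_sym => xz; apply: contraT => nadj.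
  have [q] : exists q, q \in common_nbrs x z.
    by apply/card_gt0P; rewrite common2.
  rewrite in_common => /andP[xq zq].
  (* This would give [q] at least [k + 1] neighbours: [x], [z] and the other [k - 1] neighbours of
     [x]. *)
  have sub : x |: (z |: (nbhd x :\ q)) \subset nbhd q.
    apply/subsetP=> r; rewrite !inE => /or3P[/eqP->|/eqP->|/andP[rq xr]].
    - by rewrite adj_sym.
    - by rewrite adj_sym.
    by rewrite clq // eq_sym.
  have := subset_leq_card sub; rewrite !cardsU1 !inE (negPf xz) adj_irr.
  rewrite (negPf nadj) !andbF /= regG.
  have := cardsD1 q (nbhd x); rewrite regG in_nbhd xq; clear; lia.
case: not_completeG => u v neq.
have [eq_ux|ux] := eqVneq u x; first by rewrite eq_ux univ // -eq_ux eq_sym.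
have [->|vx] := eqVneq v x; first by rewrite adj_sym univ.
by apply: clq; rewrite ?univ.
Qed.

Lemma degree_le_of_far x y z : adj x y -> adj y z -> x != z -> ~~ adj x z ->
  a x y <= l.
Proof.
move=> xy yz xz nadj.
have yC : y \in common_nbrs x z by rewrite in_common xy adj_sym.
have [q qy qC] := other_common xz nadj yC.
by rewrite -(degree_sum xz nadj qy qC yC) leq_addl.
Qed.

(** For twins, [clique_join] on [{x, y}] gives a common neighbour [p] with [a x p] about [k / 2].
    Since [p] is not a third twin, [x] has a far vertex [z] behind [p]; the second common neighbour
    [q] of [x] and [z] satisfies [a x p <= a x q], so [l >= k - 5]. *)
Lemma no_twins x y : adj x y -> a x y + 1 < k.
Proof.
move=> xy; rewrite ltnNge; apply/negP=> twin.
have neq_xy := adj_neq xy.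
have yP := twin_adj xy twin.
have [||||p pT bound] := @exists_inner_degree [set x; y] (common_nbrs x y).
- by rewrite cards2.
- by move: twin k_ge120; clear; lia.
- by move=> u v; rewrite !inE => /orP[]/eqP-> /orP[]/eqP->;
  rewrite ?eqxx // adj_sym.
- by move=> u v; rewrite in_common !inE => /orP[]/eqP-> /andP[].
have [xp yp] : adj x p /\ adj y p by apply/andP; rewrite -in_common.
have a_ge : #|nbhd p :&: common_nbrs x y| + 1 <= a x p.
  rewrite (cardsD1 y (common_nbrs x p)) in_common xy adj_sym yp addnC leq_add2l.
  apply/subset_leq_card/subsetP=> v; rewrite !inE => /and3P[-> -> yv].
  by rewrite eq_sym adj_neq.
have [lt_p|] := ltnP (a x p + 1) k;
  last exact: (no_three_twins xy xp (adj_neq yp)).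
have [z [pz xz nadj]] := exists_far xp lt_p.
have pC : p \in common_nbrs x z by rewrite in_common xp adj_sym.
have [q qp qC] := other_common xz nadj pC.
have [xq zq] : adj x q /\ adj z q by apply/andP; rewrite -in_common.
have nyz : ~~ adj y z.
  have yx : adj y x by rewrite adj_sym.
  have twin' : k <= a y x + 1 by rewrite common_nbrsC.
  apply: contra nadj => yz; apply: (twin_adj yx twin' yz).
  by rewrite eq_sym.
have qy : q != y by apply: contraNneq nyz => <-; rewrite adj_sym.
have yq : adj y q by rewrite yP.
have pq : adj p q.
  rewrite eq_sym in qp.
  apply: (adj_of_three_common qp (p:=x) (q:=y) (r:=z)).
    rewrite /= !inE negb_or neq_xy xz /= andbT.
    by apply: contraNneq nadj => <-.
  move=> r; rewrite in_common ![adj _ r]adj_sym !inE.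
  by case/or3P=> /eqP->; rewrite ?xp ?xq ?yp ?yq ?zq // adj_sym pz.
(* Apart from [q], each common neighbour of [x] and [p] is [y] or lies with [p] and [q] in the
   common neighbourhood of [x] and [y], hence is adjacent to [q]. *)
have le_pq : a x p <= a x q.
  rewrite (cardsD1 q) [X in _ <= X](cardsD1 p) !in_common xp xq pq adj_sym pq.
  rewrite leq_add2l; apply/subset_leq_card/subsetP=> v.
  rewrite !inE => /and3P[vq xv pv]; rewrite xv eq_sym adj_neq //=.
  have [->|vy] := eqVneq v y; first by rewrite adj_sym.
  rewrite adj_sym; apply: (@diamond_free x y p) => //;
    rewrite in_common ?xv ?xq //=.
  by rewrite yP.
have := degree_sum xz nadj qp qC pC.
move: le_pq a_ge bound twin l_lt k_ge120; rewrite cards2 neq_xy; clear; lia.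
Qed.

Lemma degree_le x y : adj x y -> a x y <= l.
Proof.
move=> xy; have [z [yz xz nadj]] := exists_far xy (no_twins xy).
exact: degree_le_of_far yz xz nadj.
Qed.

(** The second common neighbour [z] of [w] and [y] lies outside [L], and not next to [x] because [x]
    and [y] share no neighbour there. So [y] and [w] are the common neighbours of the non-adjacent
    pair [x], [z]. *)
Lemma far_degree_sum L x w y : large_clique L -> x \in L -> w \notin L ->
  adj x w -> {in L, forall v, v != x -> ~~ adj w v} -> y \in L -> y != x ->
  common_nbrs x y :\: L = set0 -> a x y + a x w = l.
Proof.
move=> largeL xL wL xw nonadj yL yx noexit.
have wy : w != y by apply: contraNneq wL => ->.
have xC : x \in common_nbrs w y.
  by rewrite in_common adj_sym xw (clique_adj largeL).
have [z zx] := other_common wy (nonadj y yL yx) xC.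
rewrite in_common => /andP[wz yz].
have zL : z \notin L by apply: contraL wz => zL; apply: nonadj.
have nxz : ~~ adj x z.
  apply/negP=> xz; have := in_set0 z; rewrite -noexit.
  by rewrite in_setD in_common zL xz yz.
apply: (degree_sum (z := z)); rewrite 1?eq_sym // in_common ![adj z _]adj_sym.
  by rewrite yz (clique_adj largeL) // eq_sym.
by rewrite xw.
Qed.

Lemma third_vertex L x y : large_clique L -> x \in L -> y \in L ->
  exists z, [/\ z \in L, z != x & z != y].
Proof.
move=> /clique_size sizeL xL yL; have : 0 < #|L :\ x :\ y|.
  move: sizeL; rewrite (cardsD1 x) (cardsD1 y (L :\ x)) xL.
  by case: (y \in _); clear; lia.
by case/card_gt0P=> z; rewrite !inE => /and3P[]; exists z.
Qed.

Lemma sum_adj_exchange S T :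
  \sum_(x in S) #|nbhd x :&: T| = \sum_(y in T) #|nbhd y :&: S|.
Proof.
have -> : \sum_(x in S) #|nbhd x :&: T| =
    \sum_(x in S) \sum_(y in T | adj x y) 1.
  by apply: eq_bigr => x _; rewrite -sum1_card; apply: eq_bigl => y;
    rewrite !inE andbC.
rewrite (exchange_big_dep (mem T)) /=; last by move=> x y _ /andP[].
apply: eq_bigr => y yT; rewrite -sum1_card; apply: eq_bigl => x.
by rewrite !inE yT andbC adj_sym.
Qed.

(** * Exit triples *)

Section ExitTriple.

Variables (L : {set G}) (x c u : G).
Hypothesis largeL : large_clique L.
Hypothesis exitL : exit_triple L x c u.

Let xL : x \in L. Proof. by case/and5P: exitL => /andP[]. Qed.
Let cL : c \in L. Proof. by case/and5P: exitL => /andP[]. Qed.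
Let neq_xc : x != c. Proof. by case/and5P: exitL. Qed.
Let xc : adj x c. Proof. exact: (clique_adj largeL). Qed.

Lemma outer_nonadj w : w \notin L -> adj x w -> ~~ adj c w ->
  {in L, forall v, v != x -> ~~ adj w v}.
Proof.
move=> wL xw ncw v vL vx; apply: contra ncw => wv.
rewrite -(exit_unique largeL exitL (w := v) (u' := w)) 1?adj_sym //.
by apply: exit_tripleI; rewrite // 1?eq_sym // adj_sym.
Qed.

(** A third vertex [y] of [L] has [a x y = #|L| - 2 = l / 2], and [far_degree_sum] gives [w] the
    other half. *)
Lemma outer_degree w : w \notin L -> adj x w -> ~~ adj c w ->
  a x w + 2 = #|L|.
Proof.
move=> wL xw ncw.
have [y [yL yx yc]] := third_vertex largeL xL cL.
have deg_y := exit_nonexit_degree largeL exitL yL yx yc.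
have noexit : common_nbrs x y :\: L = set0.
  apply/eqP; rewrite -cards_eq0.
  have xy : x != y by rewrite eq_sym.
  have := card_common_clique largeL xL yL xy.
  by move: deg_y; clear; lia.
have := far_degree_sum largeL xL wL xw (outer_nonadj wL xw ncw) yL yx noexit.
have := exit_size largeL exitL; move: deg_y; clear; lia.
Qed.

(* The average of [a x y] over the neighbours [y] of [x] is at least [k / 3 - 3]
   and, with [h = #|L| - 2], less than [h + 1]. *)
Lemma exit_clique_size : 39 <= #|L|.
Proof.
pose U := common_nbrs x c :\: L; pose W := (nbhd x :\: L) :\: nbhd c.
pose h := #|L| - 2; pose q := #|U|.
have sizeL : #|L| = h + 2 by have := clique_size largeL; rewrite /h; clear; lia.
have deg_c : a x c = h + q.
  have := card_common_clique largeL xL cL neq_xc.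
  by rewrite -/U -/q sizeL; clear; lia.
have lE : l = 2 * h by have := exit_size largeL exitL; rewrite sizeL; clear;
  lia.
have le_qh : q <= h by have := degree_le xc; rewrite deg_c lE; clear; lia.
have defL : nbhd x :&: L = L :\ x.
  apply/setP=> v; rewrite !inE andbC; case: (boolP (v \in L)) => vL;
    rewrite ?andbF //=.
  have [->|vx] := eqVneq v x; first by rewrite adj_irr.
  by rewrite (clique_adj largeL) // eq_sym.
have defU : (nbhd x :\: L) :&: nbhd c = U.
  by apply/setP=> v; rewrite !inE andbA.
have cardL1 : #|L :\ x| = h + 1.
  by have := cardsD1 x L; rewrite xL sizeL; clear; lia.
have cardL2 : #|L :\ x :\ c| = h.
  have := cardsD1 c (L :\ x); rewrite in_setD1 cL eq_sym neq_xc cardL1; clear;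
    lia.
have kE : k = h + 1 + q + #|W|.
  rewrite -(regG x) -(cardsID L) defL cardL1 -(cardsID (nbhd c) (nbhd x :\: L)).
  by rewrite defU addnA.
have sumL : \sum_(y in nbhd x :&: L) a x y = h + q + h * h.
  rewrite defL (big_setD1 c) /=; last by rewrite in_setD1 cL eq_sym neq_xc.
  rewrite deg_c; congr (_ + _).
  rewrite (eq_bigr (fun=> h)) ?sum_nat_const ?cardL2 // => v.
  rewrite !inE => /and3P[vc vx vL].
  have := exit_nonexit_degree largeL exitL vL vx vc; rewrite sizeL; clear; lia.
have sumW : \sum_(y in W) a x y = #|W| * h.
  rewrite (eq_bigr (fun=> h)) ?sum_nat_const // => w.
  rewrite !inE => /and3P[ncw wL xw].
  have := outer_degree wL xw ncw; rewrite sizeL; clear; lia.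
(* A common neighbour of [x] and [y] is [c], another vertex of [U], or in [W]. Each vertex of [W]
   has at most one neighbour in [U]: two of them and [x] would be three common neighbours with
   [c]. *)
have sumU : \sum_(y in U) a x y <= q * q + #|W|.
  apply: (@leq_trans (\sum_(y in U) (q + #|nbhd y :&: W|))).
    apply: leq_sum => y yU; have := yU; rewrite !inE => /and3P[yL xy cy].
    have sub : common_nbrs x y \subset (c |: (U :\ y)) :|: (nbhd y :&: W).
      apply/subsetP=> v; rewrite in_common !inE => /andP[xv yv].
      have vy : v != y by rewrite eq_sym adj_neq.
      rewrite xv yv vy /=.
      have [//|vc] := eqVneq v c.
      have [vL|vL] /= := boolP (v \in L); last by case: (adj c v).
      have ex : exit_triple L x c y by apply: exit_tripleI; rewrite // adj_sym.
      have vx : v != x by rewrite eq_sym adj_neq.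
      by have := exit_nonadj largeL ex vL vx vc; rewrite yv.
    apply: (leq_trans (subset_leq_card sub)).
    apply: (leq_trans (leq_card_setU _ _).1); rewrite leq_add2r.
    have := cardsD1 y U; rewrite yU -/q cardsU1 => ->.
    by rewrite leq_add2r; case: (_ \notin _).
  rewrite big_split /= sum_nat_const leq_add2l sum_adj_exchange.
  rewrite -sum1_card; apply: leq_sum => w; rewrite !inE => /and3P[ncw wL xw].
  rewrite leqNgt; apply/negP=> /card_gt1P[v1 [v2 []]].
  rewrite !inE => /and4P[wv1 v1L xv1 cv1] /and4P[wv2 v2L xv2 cv2] neq.
  case/negP: ncw; apply: (adj_of_three_common (p:=x) (q:=v1) (r:=v2)).
  - by apply: contraNneq wL => <-.
  - by rewrite /= !inE negb_or neq !adj_neq.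
  move=> r; rewrite !inE; case/or3P=> /eqP->; rewrite ?cv1 ?cv2 //.
  by rewrite adj_sym xc adj_sym.
have := @clique_join [set x] (nbhd x).
rewrite cards1 regG /edges_between => /(_ isT) bound.
have {}bound : 1 * k ^ 2 <= (1 + 2) * (3 * k + \sum_(y in nbhd x) a x y).
  have -> : \sum_(y in nbhd x) a x y = \sum_(y in nbhd x) #|nbhd y :&: nbhd x|.
    by apply: eq_bigr => y _; rewrite -setIC.
  apply: bound => [v w|v w]; rewrite !inE => /eqP-> //.
  by move=> /eqP->; rewrite eqxx.
move: bound.
rewrite (big_setID L) sumL (big_setID (nbhd c)) /= defU -/W sumW.
move: sumU le_qh kE k_ge120; rewrite sizeL; set X := \sum_(y in U) _.
clear; move: X q h #|W| => X q h m sumU le_qh kE k_ge bound.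
(* This needs only [q * q <= h * q]. The [- 1] supplies strictness: [h <= 36] would give
   [k * k <= 120 * k - 111]. *)
have le1 : X + m * h + (h + q + h * h) <= (h + 1) * (k - 1) by nia.
have le2 : k * k <= 9 * k + 3 * ((h + 1) * (k - 1)) by lia.
rewrite leqNgt; apply/negP=> lt_h.
have le3 : (h + 1) * (k - 1) <= 37 * (k - 1) by rewrite leq_mul2r; lia.
have le4 : 120 * k <= k * k by rewrite leq_mul2r k_ge orbT.
lia.
Qed.

(** Let [z] be the second common neighbour of [c] and [w]. If it were not adjacent to [x], then
    [a x c + a x w = l]; but [a x w = l / 2] and [a x c > l / 2] because of [u]. *)
Lemma outer_adj w : w \notin L -> adj x w -> ~~ adj c w ->
  exists2 v, v \in common_nbrs x c :\: L & adj w v.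
Proof.
move=> wL xw ncw; apply/exists_inP; apply: contraT.
rewrite negb_exists_in => /forall_inP noU.
have cw : c != w by apply: contraNneq wL => <-.
have xC : x \in common_nbrs c w by rewrite in_common ![adj _ x]adj_sym xc.
have [z zx] := other_common cw ncw xC; rewrite in_common => /andP[cz wz].
have zL : z \notin L.
  by apply: contraL wz => zL; apply: (outer_nonadj wL xw ncw).
have nxz : ~~ adj x z.
  apply/negP=> xz; have zU : z \in common_nbrs x c :\: L.
    by rewrite in_setD in_common zL xz.
  by have := noU z zU; rewrite wz.
have deg : a x c + a x w = l.
  apply: (degree_sum (z := z));
    rewrite // 1?eq_sym // in_common ![adj z _]adj_sym.
    by rewrite xc.
  by rewrite xw.
have := card_common_clique largeL xL cL neq_xc.
have : 0 < #|common_nbrs x c :\: L|.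
  by rewrite card_gt0; apply/(exit_tripleP xL cL neq_xc); exists u.
have := exit_size largeL exitL; have := outer_degree wL xw ncw.
by move: deg; clear; lia.
Qed.

End ExitTriple.

(** * Intersections of large cliques *)

(** A vertex of [L'] outside [L] makes [p], [q] an exit pair of both cliques, which then have equal
    size. By [degree_le], the rest of [L'] is exactly the set of common neighbours of [p] and [q]
    outside [L]. A neighbour [w] of [p] but not of [q] sees one of these by [outer_adj], against
    [exit_unique] in [L']. *)
Lemma large_clique_sub L L' p q : large_clique L -> large_clique L' ->
  p != q -> p \in L -> q \in L -> p \in L' -> q \in L' -> L' \subset L.
Proof.
move=> largeL largeL' neq pL qL pL' qL'; apply/subsetP=> u uL'.
apply: contraT => uL.
have up : adj u p by apply: (clique_adj largeL') => //;
  apply: contraNneq uL => ->.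
have uq : adj u q by apply: (clique_adj largeL') => //;
  apply: contraNneq uL => ->.
have ex : exit_triple L p q u by apply: exit_tripleI.
have [y [yL yp yq]] := third_vertex largeL pL qL.
have yL' : y \notin L'.
  apply: contra (exit_nonadj largeL ex yL yp yq) => yL'.
  by apply: (clique_adj largeL') => //; apply: contraNneq uL => ->.
have ex' : exit_triple L' p q y.
  by apply: exit_tripleI; rewrite // (clique_adj largeL).
have pq : adj p q by apply: (clique_adj largeL).
have cardU : #|common_nbrs p q :\: L| + 2 <= #|L'|.
  have := card_common_clique largeL pL qL neq; have := degree_le pq.
  have := exit_size largeL ex; have := exit_size largeL' ex'; clear; lia.
have defU : L' :\ p :\ q = common_nbrs p q :\: L.
  apply/eqP; rewrite eqEcard; apply/andP; split.
    apply/subsetP=> v; rewrite !inE => /and3P[vq vp vL'].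
    rewrite ![adj _ v]adj_sym !(clique_adj largeL') // !andbT.
    apply/negP=> vL; case/negP: (exit_nonadj largeL ex vL vp vq).
    by apply: (clique_adj largeL') => //; apply: contraNneq uL => ->.
  move: cardU; rewrite (cardsD1 p L') pL' (cardsD1 q (L' :\ p)) in_setD1 qL'.
  by rewrite eq_sym neq; clear; lia.
have [w [pw qw nqw]] : exists w, [/\ adj p w, q != w & ~~ adj q w].
  by apply: exists_far; rewrite 1?adj_sym // no_twins // adj_sym.
have wL : w \notin L.
  by apply: contra nqw => wL; apply: (clique_adj largeL).
have wL' : w \notin L'.
  by apply: contra nqw => wL'; apply: (clique_adj largeL').
have [v vU wv] := outer_adj largeL ex wL pw nqw.
move: vU; rewrite -defU !inE => /and3P[vq vp vL'].
have ex'' : exit_triple L' p v w.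
  by apply: exit_tripleI; rewrite // 1?eq_sym // adj_sym.
by rewrite (exit_unique largeL' ex' ex'') eqxx in vq.
Qed.

Lemma large_clique_inj L L' p q : large_clique L -> large_clique L' ->
  p != q -> p \in L -> q \in L -> p \in L' -> q \in L' -> L = L'.
Proof.
move=> largeL largeL' neq pL qL pL' qL'; apply/eqP; rewrite eqEsubset.
by rewrite !(large_clique_sub _ _ neq).
Qed.

Lemma second_clique_exit L M x c u : large_clique L -> large_clique M ->
  exit_triple L x c u -> x \in M -> u \in M -> exit_triple M x u c.
Proof.
move=> largeL largeM /and5P[/andP[xL cL] xc uL ux uc] xM uM.
have cM : c \notin M.
  apply: contra uL => cM.
  by rewrite (large_clique_inj largeL largeM xc).
apply: exit_tripleI; rewrite 1?eq_sym ?adj_neq // 1?adj_sym //.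
by apply: (clique_adj largeL).
Qed.

(** The large clique through [x] and [u] has the size of [L] by [exit_size], and [c] is one more
    common neighbour outside it. *)
Lemma heavy_degree L x c u : large_clique L -> exit_triple L x c u ->
  37 <= a x u -> #|L| <= a x u + 1.
Proof.
move=> largeL ex a_ge.
have /and5P[_ _ _ ux _] := ex; rewrite adj_sym in ux.
have [M [largeM xM uM]] := exists_large_clique ux a_ge.
have exM := second_clique_exit largeL largeM ex xM uM.
have := card_common_clique largeM xM uM (adj_neq ux).
have : 0 < #|common_nbrs x u :\: M|.
  by rewrite card_gt0; apply/(exit_tripleP xM uM (adj_neq ux)); exists c.
have := exit_size largeL ex; have := exit_size largeM exM; clear; lia.
Qed.

(* Each such [u] lies with [x] in a second large clique, in which no vertex other
   than [x] and [u] is adjacent to a neighbour of [x] outside the clique; picking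
   one such vertex from each clique gives an independent set. *)
Lemma card_heavy L x c u0 : large_clique L -> exit_triple L x c u0 ->
  #|[set u in common_nbrs x c :\: L | 37 <= a x u]| <= 9.
Proof.
move=> largeL /and5P[/andP[xL cL] neq_xc _ _ _].
set H := [set u in _ | _].
pose Q u y (M : {set G}) :=
  [&& large_clique M, exit_triple M x u c, y \in M, y != x & y != u].
pose f u := odflt u [pick y | [exists M : {set G}, Q u y M]].
have fP u : u \in H -> exists M, Q u (f u) M.
  rewrite /H in_set in_setD in_common => /andP[/and3P[uL xu cu] a_ge].
  have ex : exit_triple L x c u by apply: exit_tripleI; rewrite // adj_sym.
  have [M [largeM xM uM]] := exists_large_clique xu a_ge.
  have [y [yM yx yu]] := third_vertex largeM xM uM.
  rewrite /f; case: pickP => [y' /existsP //|/(_ y)/existsP[]]; exists M.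
  apply/and5P; split=> //; exact: second_clique_exit largeL largeM ex xM uM.
have indep u u' : u \in H -> u' \in H -> u != u' ->
    (f u != f u') && ~~ adj (f u) (f u').
  move=> /fP[M /and5P[largeM ex yM yx yu]] /fP[M'
    /and5P[largeM' ex' yM' yx' yu']] neq.
  have [/andP[xM uM] _ _ _ _] := and5P ex.
  have [/andP[xM' uM'] _ _ _ _] := and5P ex'.
  have y'M : f u' \notin M.
    apply: contra neq => y'M.
    have eqM : M = M'.
      by apply: (large_clique_inj largeM largeM' (p := x) (q := f u'));
        rewrite // eq_sym.
    rewrite -eqM in ex'; by rewrite (exit_unique largeM ex ex').
  apply/andP; split; first by apply: contraNneq y'M => <-.
  apply: contra yu => yy'.
  have y'x : adj (f u') x by apply: (clique_adj largeM').
  have ex2 : exit_triple M x (f u) (f u').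
    by apply: exit_tripleI; rewrite // 1?eq_sym // adj_sym.
  by rewrite (exit_unique largeM ex ex2).
rewrite -(card_in_imset (f := f)); last first.
  move=> u u' uH u'H eq_f; apply/eqP/negPn/negP=> neq.
  by have := indep u u' uH u'H neq; rewrite eq_f eqxx.
apply: (@independent_le9 x).
  apply/subsetP=> y /imsetP[u /fP[M /and5P[largeM ex yM yx _]] ->].
  have [/andP[xM _] _ _ _ _] := and5P ex.
  by rewrite inE (clique_adj largeM) // eq_sym.
move=> y y' /imsetP[u uH ->] /imsetP[u' u'H ->].
have [->|neq] := eqVneq u u'; first by rewrite adj_irr.
by case/andP: (indep u u' uH u'H neq).
Qed.

(** Write [U] for the common neighbours of [x] and [c] outside [L]. If [a x v < 37], then
    [#|U| <= 18], [a x v = #|L| - 2 - #|U|] and [a x v <= #|U|], so [#|L| <= 38], against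
    [exit_clique_size]. *)
Lemma exit_heavy L x c v : large_clique L -> exit_triple L x c v ->
  37 <= a x v.
Proof.
move=> largeL ex; rewrite leqNgt; apply/negP=> light.
have sizeL := exit_clique_size largeL ex; have lE := exit_size largeL ex.
have /and5P[/andP[xL cL] neq_xc vL vx vc] := ex.
have exC := exit_tripleC ex.
set U := common_nbrs x c :\: L.
have sumU u : u \in U -> a x u + a c u = l.
  rewrite in_setD in_common => /and3P[uL xu cu].
  rewrite ![common_nbrs _ u]common_nbrsC; apply: (exit_outer_degree largeL).
  by apply: exit_tripleI; rewrite // adj_sym.
have vU : v \in U by rewrite in_setD in_common vL ![adj _ v]adj_sym vx vc.
(* As [l >= 2 * 39 - 4 = 74], each vertex of [U] has degree at least 37 with [x] or with [c];
   [card_heavy] bounds both kinds by 9. *)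
have cardU : #|U| <= 18.
  have := card_heavy largeL ex; have := card_heavy largeL exC.
  rewrite [common_nbrs c x]common_nbrsC -/U.
  set H1 := [set u in _ | _]; set H2 := [set u in _ | _] => le1 le2.
  have sub : U \subset H1 :|: H2.
    apply/subsetP=> u uU; rewrite in_setU [u \in H1]in_set [u \in H2]in_set uU.
    by have := sumU u uU; move: lE sizeL; clear; lia.
  have := subset_leq_card sub; have := (leq_card_setU H1 H2).1.
  by move: le1 le2; clear; lia.
(* Seen from the large clique through [c] and [v], the outside vertex is [x]. *)
have deg_xc : a x c + a x v = l.
  have cv_ge : 37 <= a c v by have := sumU v vU; move: lE sizeL light; clear;
    lia.
  have cv : adj c v by rewrite adj_sym.
  have [M [largeM cM vM]] := exists_large_clique cv cv_ge.
  have exM := second_clique_exit largeL largeM exC cM vM.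
  exact: (exit_outer_degree largeM exM).
have le_q : a x v <= #|U|.
  suff sub : common_nbrs x v \subset c |: (U :\ v).
    apply: (leq_trans (subset_leq_card sub)); rewrite (cardsD1 v U) vU cardsU1.
    by rewrite leq_add2r; case: (_ \notin _).
  apply/subsetP=> w; rewrite in_common => /andP[xw vw].
  rewrite in_setU1 in_setD1 in_setD in_common xw.
  have [//|wc] := eqVneq w c.
  rewrite eq_sym adj_neq //=.
  have [wL|wL] /= := boolP (w \in L).
    have wx : w != x by rewrite eq_sym adj_neq.
    by have := exit_nonadj largeL ex wL wx wc; rewrite vw.
  (* Otherwise [x] and [w] lie in a large clique [M] that [v] exits at [x], [w]. A third vertex [w']
     of [M] has by [outer_adj] a neighbour in [U], outside [M], so [w'] would be a second exit
     partner of [x]. *)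
  apply: contraT => ncw.
  have deg_w := outer_degree largeL ex wL xw ncw.
  have w_ge : 37 <= a x w by move: deg_w sizeL; clear; lia.
  have [M [largeM xM wM]] := exists_large_clique xw w_ge.
  have vM : v \notin M.
    apply: contraL light => vM; rewrite -leqNgt.
    have exM := second_clique_exit largeL largeM ex xM vM.
    have xv : x != v by rewrite eq_sym adj_neq.
    have := card_common_clique largeM xM vM xv.
    by have := exit_size largeM exM; move: lE sizeL; clear; lia.
  have exM : exit_triple M x w v by apply: exit_tripleI; rewrite // adj_neq.
  have cM : c \notin M.
    by apply: contra ncw => cM; apply: (clique_adj largeM); rewrite // eq_sym.
  have cx : adj c x by apply: (clique_adj largeL); rewrite // eq_sym.
  have noc y : y \in M -> y != x -> ~~ adj c y.
    move=> yM yx; apply/negP=> cy.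
    have exy : exit_triple M x y c by apply: exit_tripleI; rewrite // eq_sym.
    by rewrite (exit_unique largeM exM exy) (negPf ncw) in cy.
  have [w' [w'M w'x w'w]] := third_vertex largeM xM wM.
  have w'L : w' \notin L.
    apply: contra wL => w'L; rewrite eq_sym in w'x.
    by rewrite (large_clique_inj largeL largeM w'x).
  have xw' : adj x w' by apply: (clique_adj largeM); rewrite // eq_sym.
  have [u'] := outer_adj largeL ex w'L xw' (noc w' w'M w'x).
  rewrite in_setD in_common => /and3P[u'L xu' cu'] w'u'.
  have u'M : u' \notin M.
    apply: contraL cu' => u'M; apply: noc => //; rewrite eq_sym.
    exact: adj_neq.
  have exw' : exit_triple M x w' u'.
    by apply: exit_tripleI; rewrite // 1?eq_sym // adj_sym.
  by rewrite (exit_unique largeM exM exw') eqxx in w'w.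
have := card_common_clique largeL xL cL neq_xc.
rewrite -/U; move: cardU deg_xc le_q lE sizeL; clear; lia.
Qed.

(** Both [a p u] and [a q u] are at least [#|L| - 1], but they sum to [l = 2 * #|L| - 4]. *)
Lemma no_exit L p q u : large_clique L -> ~~ exit_triple L p q u.
Proof.
move=> largeL; apply/negP=> ex; have exC := exit_tripleC ex.
have := exit_outer_degree largeL ex; have := exit_size largeL ex.
have := heavy_degree largeL ex (exit_heavy largeL ex).
have := heavy_degree largeL exC (exit_heavy largeL exC).
have := clique_size largeL.
rewrite ![common_nbrs u _]common_nbrsC; clear; lia.
Qed.

(** * The partial linear space of large cliques *)

Lemma clique_degree L x y : large_clique L -> x \in L -> y \in L -> x != y ->
  a x y + 2 = #|L|.
Proof.
move=> largeL xL yL xy; rewrite (card_common_clique largeL) //.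
suff -> : common_nbrs x y :\: L = set0 by rewrite cards0 addn0.
apply/eqP/negPn/(exit_tripleP xL yL xy) => -[u].
exact/negP/no_exit.
Qed.

(* Every [w] outside [L] has the same degree [l - a x y] in the neighbourhood of
   [x]; some vertex at distance two from [x] must see two such vertices, for
   otherwise [w] would have too few neighbours. *)
Lemma degree_half x y : adj x y -> 2 * a x y = l.
Proof.
have [y0 xy0 a_ge] := exists_degree_ge37 x.
have [L [largeL xL y0L]] := exists_large_clique xy0 a_ge.
have deg_in v : v \in L -> v != x -> a x v + 2 = #|L|.
  by move=> vL vx; apply: clique_degree; rewrite // eq_sym.
have out_nonadj w : w \notin L -> adj x w ->
    {in L, forall v, v != x -> ~~ adj w v}.
  move=> wL xw v vL vx; apply/negP=> wv.
  case/negP: (no_exit x v w largeL).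
  by apply: exit_tripleI; rewrite // 1?eq_sym // adj_sym.
have y0x : y0 != x by rewrite eq_sym adj_neq.
have deg_out w : w \notin L -> adj x w -> a x y0 + a x w = l.
  move=> wL xw; apply: (far_degree_sum largeL) => //; first exact: out_nonadj.
  apply/eqP/negPn/(exit_tripleP xL y0L (adj_neq xy0)) => -[u].
  exact/negP/no_exit.
have [w wL xw] : exists2 w, w \notin L & adj x w.
  have : 0 < #|nbhd x :\: L|.
    have := cardsID L (nbhd x); rewrite regG.
    have : #|nbhd x :&: L| <= #|L :\ x|.
      apply/subset_leq_card/subsetP=> v; rewrite !inE => /andP[xv ->].
      by rewrite eq_sym adj_neq.
    have := cardsD1 x L; rewrite xL.
    have := no_twins xy0; have := deg_in y0 y0L y0x; clear; lia.
  by case/card_gt0P=> w; rewrite !inE => /andP[]; exists w.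
suff half : 2 * a x w = l.
  move=> xy; have [yL|yL] := boolP (y \in L).
    have yx : y != x by rewrite eq_sym adj_neq.
    have := deg_in y yL yx; have := deg_in y0 y0L y0x; have := deg_out w wL xw.
    by move: half; clear; lia.
  have := deg_out y yL xy; have := deg_out w wL xw.
  by move: half; clear; lia.
apply/eqP; apply: contraT => not_half.
pose Z := (nbhd w :\ x) :\: nbhd x.
have cardZ : #|Z| + a x w + 1 = k.
  rewrite -(regG w) (cardsD1 x (nbhd w)) in_nbhd adj_sym xw.
  rewrite -(cardsID (nbhd x) (nbhd w :\ x)) -/Z.
  have -> : (nbhd w :\ x) :&: nbhd x = common_nbrs x w.
    apply/setP=> z; rewrite !inE andbC; have [->|] := eqVneq z x => //=.
    by rewrite adj_irr.
  by clear; lia.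
pose f z := odflt z [pick y in L :\ x | adj y z].
have fP z : z \in Z -> (f z \in L :\ x) && adj (f z) z.
  rewrite !inE => /and3P[nxz zx wz].
  have xz : x != z by rewrite eq_sym.
  have wC : w \in common_nbrs x z by rewrite in_common xw adj_sym.
  have [q qw qC] := other_common xz nxz wC.
  have [xq zq] : adj x q /\ adj z q by apply/andP; rewrite -in_common.
  (* If [q] were outside [L], it would have the same degree with [x] as [w], and the two would sum
     to [l], giving [2 * a x w = l]. *)
  have qL : q \in L.
    apply: contraT => qL; have := degree_sum xz nxz qw qC wC.
    have := deg_out q qL xq; have := deg_out w wL xw.
    by move: not_half; clear; lia.
  have qx : q != x by rewrite eq_sym adj_neq.
  rewrite /f; case: pickP => [v //=|/(_ q)]; first by rewrite !inE.
  by rewrite !inE qx qL adj_sym zq.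
have injf : {in Z &, injective f}.
  move=> z z' zZ z'Z eq_f; apply/eqP; apply: contraT => neq.
  have /andP[] := fP z zZ; have /andP[_] := fP z' z'Z.
  rewrite -eq_f in_setD1 => fz' /andP[fx fL] fz.
  move: zZ z'Z; rewrite !inE => /and3P[nxz zx wz] /and3P[nxz' zx' wz'].
  case/negP: (out_nonadj w wL xw _ fL fx).
  apply: (adj_of_three_common (p:=x) (q:=z) (r:=z')).
  - by apply: contraNneq wL => ->.
  - by rewrite /= !inE negb_or neq ![x == _]eq_sym zx zx'.
  move=> r; rewrite in_common !inE; case/or3P=> /eqP->; rewrite ?wz ?wz' //.
  by rewrite adj_sym xw (clique_adj largeL).
(* With [cardZ] this gives [k <= a x y0 + a x w + 2 = l + 2], impossible for [4 * l < 3 * k]. *)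
have : #|Z| <= #|L :\ x|.
  rewrite -(card_in_imset injf); apply/subset_leq_card/subsetP=> v.
  by case/imsetP=> z zZ ->; case/andP: (fP z zZ).
have := cardsD1 x L; rewrite xL; have := deg_in y0 y0L y0x.
have := deg_out w wL xw; move: cardZ l_lt k_ge120; clear; lia.
Qed.

(** * Counting points and lines *)

(** A double count of the edges between [nbhd x] and the vertices at distance two: each far vertex
    has two of them, each neighbour [k - 1 - l / 2]. The leading 2 clears the half. *)
Lemma far_count x :
  2 * #|[set z | (z != x) && ~~ adj x z]| * 2 = k * (2 * k - 2 - l).
Proof.
set F := [set z | _].
have sumF : \sum_(z in F) #|nbhd z :&: nbhd x| = #|F| * 2.
  rewrite (eq_bigr (fun=> 2)) ?sum_nat_const // => z;
    rewrite inE => /andP[zx nxz].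
  by rewrite -(common2 (x := x) (y := z)) 1?eq_sym // common_nbrsC.
rewrite -mulnA -sumF sum_adj_exchange big_distrr /=.
rewrite (eq_bigr (fun=> 2 * k - 2 - l)) ?sum_nat_const ?regG // => y.
rewrite inE => xy; rewrite -(degree_half xy).
have := cardsID F (nbhd y); rewrite regG.
have -> : nbhd y :\: F = x |: common_nbrs x y.
  apply/setP=> z; rewrite !inE negb_and !negbK.
  by have [->|] := eqVneq z x => //=; rewrite adj_sym.
by rewrite cardsU1 in_common adj_irr; clear; lia.
Qed.

(** The large cliques through [x], with [x] removed, partition [nbhd x] into blocks of size
    [l / 2 + 1]. *)
Lemma lines_through x : #|[set L | large_clique L & x \in L]| * (l + 2) = 2 * k.
Proof.
set P := [set L | _ & _].
have cardL L : L \in P -> 2 * #|L :\ x| = l + 2.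
  rewrite inE => /andP[largeL xL].
  have [z [zL zx _]] := third_vertex largeL xL xL.
  have xz : x != z by rewrite eq_sym.
  have := clique_degree largeL xL zL xz.
  rewrite -(degree_half (clique_adj largeL xL zL xz)).
  by have := cardsD1 x L; rewrite xL; clear; lia.
have -> : #|P| * (l + 2) = 2 * \sum_(L in P) #|L :\ x|.
  by rewrite big_distrr /= (eq_bigr _ cardL) sum_nat_const.
congr (2 * _).
transitivity (\sum_(L in P) \sum_(y in nbhd x | y \in L) 1).
  apply: eq_bigr => L; rewrite inE => /andP[largeL xL]; rewrite -sum1_card.
  apply: eq_bigl => y; rewrite !inE; have [yL|] := boolP (y \in L);
    rewrite ?andbF //.
  have [->|yx] := eqVneq y x; first by rewrite adj_irr.
  by rewrite (clique_adj largeL) // eq_sym.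
rewrite (exchange_big_dep (mem (nbhd x))) /=; last by move=> L y _ /andP[].
rewrite -(regG x) -sum1_card; apply: eq_bigr => y; rewrite inE => xy.
have a_ge : 37 <= a x y.
  have [y0 xy0] := exists_degree_ge37 x.
  have := degree_half xy0; have := degree_half xy; clear; lia.
have [L [largeL xL yL]] := exists_large_clique xy a_ge.
rewrite (big_pred1 L) // => M; rewrite !inE xy /=.
apply/andP/eqP=> [[/andP[largeM xM] yM]|->]; last by rewrite largeL xL.
exact: (large_clique_inj largeM largeL (adj_neq xy)).
Qed.

(* With [t = l
  / 2 + 1], each vertex lies on three lines of [t + 1] points, so the
   number of lines times [t + 1] is [3 n = 9 t (t + 1) + 3]. *)
Lemma strongly_co_edge_regular_false (x0 : G) : False.
Proof.
have [y0 xy0 a_ge] := exists_degree_ge37 x0.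
set h := a x0 y0 in a_ge; have lE : l = 2 * h by rewrite -(degree_half xy0).
have le_k : k <= 9 + 3 * h.
  have [||||y] := @exists_inner_degree [set x0] (nbhd x0).
  - by rewrite cards1.
  - by rewrite regG; move: k_ge120; clear; lia.
  - by move=> u v; rewrite !inE => /eqP-> /eqP->; rewrite eqxx.
  - by move=> u v; rewrite !inE => /eqP->.
  rewrite inE cards1 regG setIC -/(common_nbrs x0 y) => xy.
  by have := degree_half xy; rewrite lE; clear; lia.
(* The count [r] satisfies [r * (h + 1) = k]. At most two lines contradict [8 * h < 3 * k], at least
   four contradict [k <= 9 + 3 * h], since [h >= 37]. *)
have three x : #|[set L | large_clique L & x \in L]| = 3.
  have := lines_through x; rewrite lE; set r := #|_|.
  have : 8 * h < 3 * k by move: l_lt; rewrite lE; clear; lia.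
  move: le_k a_ge; clear; move: h r k => h r k' le_k a_ge lt_h rE.
  by case: r rE => [|[|[|[|r]]]] rE; nia.
have kE : k = 3 * (h + 1).
  by have := lines_through x0; rewrite three lE; clear; lia.
pose P := [set L : {set G} | large_clique L].
have sizeL L : L \in P -> #|L| = h + 2.
  rewrite inE => largeL; have : 0 < #|L| by have := clique_size largeL; clear;
    lia.
  case/card_gt0P=> x xL; have [z [zL zx _]] := third_vertex largeL xL xL.
  have xz : x != z by rewrite eq_sym.
  have := clique_degree largeL xL zL xz.
  by have := degree_half (clique_adj largeL xL zL xz); rewrite lE; clear; lia.
have flags : #|P| * (h + 2) = 3 * #|G|.
  rewrite -sum_nat_const -(eq_bigr _ sizeL).
  transitivity (\sum_(L in P) \sum_(x in L) 1).
    by apply: eq_bigr => L _; rewrite sum1_card.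
  rewrite (exchange_big_dep predT) //= mulnC -sum_nat_const.
  apply: eq_bigr => x _; rewrite -(three x) -sum1_card; apply: eq_bigl => L.
  by rewrite !inE.
have cardG : #|G| = 1 + k + #|[set z | (z != x0) && ~~ adj x0 z]|.
  have := cardsC (x0 |: nbhd x0); rewrite cardsU1 in_nbhd adj_irr regG /= => <-.
  by congr (_ + _); apply: eq_card => z; rewrite !inE negb_or.
have := far_count x0; move: flags a_ge; rewrite cardG lE kE.
set F := #|[set z | _]|; clear; move: #|P| F h => b F h.
have -> : 2 * (3 * (h + 1)) - 2 - 2 * h = 4 * (h + 1) by lia.
move=> flags a_ge far; have FE : F = 3 * (h + 1) * (h + 1) by lia.
move: flags; rewrite FE => flags {far FE F}.
(* The equation is [b * (h + 2) = 9 * (h + 1) * (h + 2) + 3]: the right side lies strictly between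
   consecutive multiples of [h + 2]. *)
have [le_b|lt_b] := leqP b (9 * (h + 1)).
  have : b * (h + 2) <= 9 * (h + 1) * (h + 2) by rewrite leq_mul2r le_b orbT.
  by lia.
have : (9 * (h + 1)).+1 * (h + 2) <= b * (h + 2) by rewrite leq_mul2r lt_b orbT.
by lia.
Qed.


End StronglyCoEdgeRegular.

Theorem theorem4p3 (R : rcfType) (n k l : nat) (theta_min : R) :
  ~ exists G : sgraph,
      [/\ strongly_co_edge_regular G n k 2 l,
          smallest_eigenvalue G theta_min,
          -3 <= theta_min,
          (120 <= k)%N &
          l%:R < 3 * k%:R / 4 :> R].
Proof.
case=> G [[[_ regG not_completeG not_edgelessG common2] sum_common]].
move=> minG theta_ge k_ge l_lt.
have {}l_lt : (4 * l < 3 * k)%N by rewrite -(ltr_nat R) !natrM; lra.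
(* A graph without vertices would be edgeless. *)
have [x0 _|noG] := pickP (predT : pred G); last first.
  by case: not_edgelessG => x; have := noG x.
apply: (strongly_co_edge_regular_false regG not_completeG common2 sum_common
          k_ge l_lt _ x0) => D S.
exact: clique_join_bound minG theta_ge.
Qed.
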